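(* Let $\epsilon>0$, let $N$ be a positive integer, $h=2\pi/N$, and let $G(\mathbf{u})=\epsilon D\mathbf{u}+\frac1\epsilon f(\mathbf{u})$ on $\mathbb{R}^N$. Consider an $s$-stage explicit Runge--Kutta scheme applied to $\mathbf{u}'=G(\mathbf{u})$ that satisfies the RK-SSP condition with Shu--Osher coefficients $(\alpha_{ik},\beta_{ik})$ and whose stages can be written in the form $$\mathbf{v}_0=\mathbf{u}_n,\qquad \mathbf{v}_i=\sum_{k=0}^{i-1}p_{ik}\mathbf{v}_k+d_i\tau G(\mathbf{v}_{i-1})\quad(1\le i\le s),\qquad \mathbf{u}_{n+1}=\mathbf{v}_s,$$ with $\sum_{k=0}^{i-1}p_{ik}=1$ for $1\le i\le s$ (the $p_{ik}$ may be negative) and $d_i\neq0$. Define the upper triangular $s\times s$ matrix $\Phi$ by $$\Phi_{ij}=\sum_{k=0}^{i-1}\frac{p_{jk}}{d_j}\quad(1\le i\le j\le s),\qquad \Phi_{ij}=0\quad(i>j),$$ and the energy discriminant $\Delta_E=\frac12(\Phi+\Phi^T)$. If $\Delta_E$ is positive-definite, with smallest eigenvalue $\lambda$, then the energy is non-increasing, i.e. $E(\mathbf{u}_{n+1})\le E(\mathbf{u}_n)$ whenever $\|\mathbf{u}_n\|_\infty\le1$, under the time-step restriction $$\tau\le\min\left\{\frac{\lambda}{\frac1\epsilon+\frac{2\epsilon}{h^2}},\ \tau_{SSP}\right\}.$$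
   Context: The time step $\tau$ is positive. The spatial domain is $[0,2\pi]$ with periodic boundary condition and mesh size $h=2\pi/N$. The matrix $D_1\in\mathbb{R}^{N\times N}$ is the periodic difference matrix $(D_1\mathbf{v})_j=\frac1h(\mathbf{v}_j-\mathbf{v}_{j-1})$ with indices modulo $N$, and $D=-D_1^TD_1$, i.e. $(D\mathbf{v})_j=\frac{1}{h^2}(\mathbf{v}_{j+1}-2\mathbf{v}_j+\mathbf{v}_{j-1})$ with indices modulo $N$. The potential is $F(u)=\frac14(1-u^2)^2$, and $f(u)=-F'(u)=u-u^3$ is applied componentwise to vectors. $\|\cdot\|_\infty$ is the maximum norm on $\mathbb{R}^N$. The discrete energy is $$E(\mathbf{u})=-\frac{\epsilon}{2}\mathbf{u}^TD\mathbf{u}+\frac1\epsilon\sum_{j=1}^NF(\mathbf{u}_j).$$ An $s$-stage explicit Runge--Kutta scheme with coefficients $a_{ik}$ ($0\le k<i\le s$) is $\mathbf{v}_0=\mathbf{u}_n$, $\mathbf{v}_i=\mathbf{u}_n+\tau\sum_{j=0}^{i-1}a_{ij}G(\mathbf{v}_j)$ for $1\le i\le s$, $\mathbf{u}_{n+1}=\mathbf{v}_s$. It satisfies the RK-SSP condition with Shu--Osher coefficients $(\alpha_{ik},\beta_{ik})$ if $\beta_{ik}=a_{ik}-\sum_{j=k+1}^{i-1}\alpha_{ij}a_{jk}$ for $0\le k\le i-1$ (so that the same stages are given by $\mathbf{v}_i=\sum_{k=0}^{i-1}(\alpha_{ik}\mathbf{v}_k+\tau\beta_{ik}G(\mathbf{v}_k))$),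 $\sum_{k=0}^{i-1}\alpha_{ik}=1$ for $1\le i\le s$, $\alpha_{ik}\ge0$ and $\beta_{ik}\ge0$ for $0\le k<i\le s$, and $\beta_{ik}=0$ whenever $\alpha_{ik}=0$. That the same scheme has the form with coefficients $p_{ik},d_i$ means that $\sum_{k=0}^{i-1}p_{ik}=1$, $d_i=a_{i,i-1}$, and $a_{ik}=\sum_{l=k+1}^{i-1}a_{lk}p_{il}$ for $0\le k\le i-2$, $1\le i\le s$. The SSP time-step bound is $$\tau_{SSP}=\min_{0\le k<i\le s}\frac{\alpha_{ik}}{\beta_{ik}}\cdot\tau_0,\qquad\tau_0=\min\left\{\frac{h^2}{4\epsilon},\frac\epsilon4\right\},$$ with the ratio $\alpha_{ik}/\beta_{ik}$ understood as $+\infty$ when $\beta_{ik}=0$. *)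

(* Defs.v *)
From mathcomp Require Import all_boot all_order all_algebra.
From mathcomp Require Import reals constructive_ereal ereal topology normedtype trigo.

Set Implicit Arguments.
Unset Strict Implicit.
Unset Printing Implicit Defensive.

Import Order.TTheory GRing.Theory Num.Theory.
Import numFieldNormedType.Exports.

Local Open Scope ring_scope.

(* Vectors of R^N are column vectors 'cV[R]_N, their indices
   being 0 .. N-1 and read modulo N through ord_pred; the norm `|u| that
   MathComp-Analysis puts on matrices is the maximum norm. *)

Section AllenCahn.
Context {R : realType}.

Definition mesh (N : nat) : R := 2 * pi / N%:R.

(* For N = 1 both Kronecker symbols coincide and D1 = 0. *)
Definition D1 (N : nat) : 'M[R]_N :=
  \matrix_(i, j) ((mesh N)^-1 * ((j == i)%:R - (j == ord_pred i)%:R)).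

Definition laplacian (N : nat) : 'M[R]_N := - ((D1 N)^T *m D1 N).

Definition F (x : R) : R := (1 - x ^+ 2) ^+ 2 / 4.

(* f = - F' *)
Definition f (x : R) : R := x - x ^+ 3.

Definition G (N : nat) (eps : R) (u : 'cV[R]_N) : 'cV[R]_N :=
  eps *: (laplacian N *m u) + eps^-1 *: map_mx f u.

Definition energy (N : nat) (eps : R) (u : 'cV[R]_N) : R :=
  - (eps / 2) * (u^T *m laplacian N *m u) 0 0
  + eps^-1 * \sum_(j < N) F (u j 0).

End AllenCahn.

(* Coefficients are total functions of natural-number indices, of which only
   the entries (i, k) with k < i <= s (and d i with 1 <= i <= s) are used. *)
Section RungeKutta.
Context {R : realType}.
Implicit Types (s : nat) (a alpha beta p : nat -> nat -> R) (d : nat -> R).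

Definition rk_step s a (N : nat) (tau : R) (g : 'cV[R]_N -> 'cV[R]_N)
    (u u' : 'cV[R]_N) : Prop :=
  exists v : nat -> 'cV[R]_N,
    [/\ v 0%N = u,
        (forall i : nat, (1 <= i <= s)%N ->
           v i = u + tau *: \sum_(0 <= j < i) a i j *: g (v j))
      & u' = v s].

Record rk_ssp s a alpha beta : Prop := RkSsp {
  rk_ssp_betaE : forall i k : nat, (k < i <= s)%N ->
    beta i k = a i k - \sum_(k.+1 <= j < i) alpha i j * a j k;
  rk_ssp_sum : forall i : nat, (1 <= i <= s)%N ->
    \sum_(0 <= k < i) alpha i k = 1;
  rk_ssp_alpha_ge0 : forall i k : nat, (k < i <= s)%N -> 0 <= alpha i k;
  rk_ssp_beta_ge0 : forall i k : nat, (k < i <= s)%N -> 0 <= beta i k;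
  rk_ssp_beta0 : forall i k : nat, (k < i <= s)%N ->
    alpha i k = 0 -> beta i k = 0 }.

(* The scheme with coefficients a has stages
   v_i = \sum_(k < i) p i k *: v_k + (d i * tau) *: G(v_(i-1)). *)
Record rk_pform s a p d : Prop := RkPform {
  rk_pform_sum : forall i : nat, (1 <= i <= s)%N ->
    \sum_(0 <= k < i) p i k = 1;
  rk_pform_d : forall i : nat, (1 <= i <= s)%N -> d i = a i i.-1;
  rk_pform_a : forall i k : nat, (1 <= i <= s)%N -> (k.+2 <= i)%N ->
    a i k = \sum_(k.+1 <= l < i) a l k * p i l }.

Definition ssp_ratio alpha beta (i k : nat) : \bar R :=
  if beta i k == 0 then +oo%E else (alpha i k / beta i k)%:E.

Definition tau0 (N : nat) (eps : R) : R :=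
  Num.min (mesh N ^+ 2 / (4 * eps)) (eps / 4).

Definition tau_ssp s alpha beta (N : nat) (eps : R) : \bar R :=
  ((\big[Order.min/+oo]_(1 <= i < s.+1)
      \big[Order.min/+oo]_(0 <= k < i) ssp_ratio alpha beta i k)
   * (tau0 N eps)%:E)%E.

(* The 0-based entry (i, j) is the 1-based entry (i + 1, j + 1). *)
Definition Phi s p d : 'M[R]_s :=
  \matrix_(i, j) (if (i <= j)%N
                  then \sum_(0 <= k < i.+1) p j.+1 k / d j.+1 else 0).

Definition energy_discriminant s p d : 'M[R]_s :=
  2^-1 *: (Phi s p d + (Phi s p d)^T).

End RungeKutta.

Section Spectrum.
Context {R : realType}.

Definition posdefmx (n : nat) (A : 'M[R]_n) : Prop :=
  A^T = A /\ forall x : 'cV[R]_n, x != 0 -> 0 < (x^T *m A *m x) 0 0.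

Definition smallest_eigenvalue (n : nat) (A : 'M[R]_n) (lam : R) : Prop :=
  eigenvalue A lam /\ forall mu : R, eigenvalue A mu -> lam <= mu.

End Spectrum.

(* Main.v *)
Require Import Defs.
From mathcomp Require Import all_boot all_order all_algebra.
From mathcomp Require Import reals constructive_ereal ereal topology normedtype trigo.
From mathcomp Require Import boolp classical_sets derive ring lra.

Import Order.TTheory GRing.Theory Num.Theory.
Import numFieldNormedType.Exports.

Local Open Scope ring_scope.

(* With w_j = v_j - v_(j-1), the p-form of the scheme telescopes to
   G(v_(j-1)) = tau^-1 sum_m Phi_mj w_m.  Since F'' <= 2 on [-1, 1] and
   - D <= 4 / h^2, one stage satisfies
   E(v_j) - E(v_(j-1)) <= - <w_j, G(v_(j-1))> + (1/eps + 2 eps/h^2) |w_j|^2.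
   Summing over j, the first terms give - tau^-1 times the quadratic form of
   Delta_E, bounded below by lam.  The stages stay in [-1, 1]^N
   because, by the SSP condition, each is a convex combination of Euler steps
   of length at most tau0. *)

Lemma matrix_norm_le {R : realType} {m n} {A : 'M[R]_(m, n)} {c : R} :
  0 <= c -> reflect (forall i j, `|A i j| <= c) (`|A| <= c).
Proof.
move=> c0; rewrite [`|A|]mx_normrE; apply: (iffP idP).
  by move=> /bigmax_leP[_ H] i j; exact: (H (i, j)).
by move=> H; apply/bigmax_leP; split=> // -[i j] _; exact: H.
Qed.

(** * Quadratic forms of symmetric matrices and the Rayleigh bound *)

Section Rayleigh.
Context {R : realType} {n : nat}.
Implicit Types (A B : 'M[R]_n) (x y : 'rV[R]_n).

(** Row vectors are used because [eigenvalue] refers to left eigenvectors. *)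
Definition dot x y : R := \sum_i x 0 i * y 0 i.

Lemma dotDl x y z : dot (x + y) z = dot x z + dot y z.
Proof.
rewrite /dot -big_split; apply: eq_bigr => i _.
by rewrite mxE mulrDl.
Qed.

Lemma dotC x y : dot x y = dot y x.
Proof. by apply: eq_bigr => i _; rewrite mulrC. Qed.

Lemma dotZl c x y : dot (c *: x) y = c * dot x y.
Proof. by rewrite mulr_sumr; apply: eq_bigr => i _; rewrite mxE mulrA. Qed.

Lemma dotDr x y z : dot z (x + y) = dot z x + dot z y.
Proof. by rewrite dotC dotDl !(dotC z). Qed.

Lemma dotZr c x y : dot x (c *: y) = c * dot x y.
Proof. by rewrite dotC dotZl dotC. Qed.

Lemma dot_mulmx A x y : dot (x *m A) y = dot x (y *m A^T).
Proof.
rewrite /dot; under eq_bigr do rewrite mxE mulr_suml.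
rewrite exchange_big; apply: eq_bigr => i _ /=.
rewrite mxE mulr_sumr; apply: eq_bigr => j _; rewrite !mxE; ring.
Qed.

Lemma dot_ge0 x : 0 <= dot x x.
Proof. by apply: sumr_ge0 => i _; rewrite -expr2 sqr_ge0. Qed.

Lemma dot_eq0 x : dot x x = 0 -> x = 0.
Proof.
move=> /eqP; rewrite psumr_eq0; last by move=> i _; rewrite -expr2 sqr_ge0.
move=> /allP H; apply/rowP => i; rewrite mxE; apply/eqP.
by have := H i (mem_index_enum _); rewrite -expr2 sqrf_eq0.
Qed.

(** With [y = x *m B], the form at [x + r *: y] is [2 r |y|^2 + O(r^2)], which a small negative [r]
    would make negative unless [y = 0]. *)
Lemma psd_null_vector B x : B^T = B -> (forall y, 0 <= dot (y *m B) y) ->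
  dot (x *m B) x = 0 -> x *m B = 0.
Proof.
move=> Bsym Bpsd xB0; apply: dot_eq0; set c := dot _ _; set y := x *m B in c *.
have := Bpsd y; set q := dot (y *m B) y => q0.
(* The form at [x + r *: y] is [2 r c + r^2 q]; adding 1 to [q] keeps the denominator positive even
   if [q = 0]. *)
pose r := - (c / (q + 1)); have := Bpsd (x + r *: y).
rewrite mulmxDl -scalemxAl.
have q1 : q + 1 != 0 by rewrite gt_eqF // ltr_wpDl.
rewrite !(dotDl, dotDr, dotZl, dotZr) xB0 -/y -/q -/c.
have -> : dot (y *m B) x = c by rewrite dot_mulmx Bsym.
rewrite (_ : _ + _ = - (c ^+ 2 * ((q + 2) / (q + 1) ^+ 2))); last by rewrite /r; field.
rewrite oppr_ge0 pmulr_lle0; last by rewrite divr_gt0 ?exprn_gt0 ?ltr_wpDl.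
by move=> c2; apply/eqP; rewrite -sqrf_eq0 eq_le c2 sqr_ge0.
Qed.

Lemma continuous_quadratic A : continuous (fun x => dot (x *m A) x).
Proof.
have cX j : continuous (fun x : 'rV[R]_n => x 0 j) by exact: coord_continuous.
have cXA i : continuous (fun x : 'rV[R]_n => (x *m A) 0 i).
  rewrite (_ : (fun _ => _) = fun x : 'rV[R]_n => \sum_j x 0 j * A j i);
    last by apply/funext => x; rewrite mxE.
  apply: continuous_big => [|j _]; first exact: add_continuous.
  by move=> x; apply: continuousM; [exact: cX|exact: cst_continuous].
apply: continuous_big => [|i _]; first exact: add_continuous.
by move=> x; apply: continuousM; [exact: cXA|exact: cX].
Qed.

Lemma dot_scalar_sub A c y : dot (y *m (A - c%:M)) y = dot (y *m A) y - c * dot y y.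
Proof.
by rewrite mulmxBr mul_mx_scalar -scaleNr dotDl dotZl mulNr.
Qed.

(* The quadratic form attains its minimum on the unit sphere, and a minimizer is
   an eigenvector by psd_null_vector. *)
Lemma rayleigh_le A (lam : R) x : A^T = A -> smallest_eigenvalue A lam ->
  lam * dot x x <= dot (x *m A) x.
Proof.
move=> Asym [/eigenvalueP[e eA e0] lam_le].
have dot_gt0 y : y != 0 -> 0 < dot y y.
  move=> y0; rewrite lt_def dot_ge0 andbT.
  by apply: contra_neq y0; exact: dot_eq0.
pose S : set 'rV[R]_n := [set y | dot y y = 1]%classic.
have normS y : y != 0 -> S ((Num.sqrt (dot y y))^-1 *: y).
  move=> y0; rewrite /S /= dotZl dotZr mulrA -invfM -expr2 sqr_sqrtr ?dot_ge0 //.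
  by rewrite mulVf // gt_eqF ?dot_gt0.
have cont_sq : continuous (fun y : 'rV[R]_n => dot y y).
  by have := continuous_quadratic 1%:M; under [X in continuous X]eq_fun do rewrite mulmx1.
have compS : compact S.
  apply: bounded_closed_compact.
    exists 1; split=> // M M1 y; rewrite /S /= => Sy.
    apply/matrix_norm_le => [|i j]; first exact: le_trans (ltW M1).
    rewrite ord1 (le_trans _ (ltW M1)) // -[leRHS]normr1 -ler_sqr ?nnegrE //.
    rewrite !real_normK ?num_real // expr1n -Sy /dot (bigD1 j) //= expr2 lerDl.
    by apply: sumr_ge0 => k _; rewrite -expr2 sqr_ge0.
  have -> : S = ((fun y => dot y y) @^-1` [set 1])%classic by [].
  by apply: preimage_closed => [? _|]; [exact: cont_sq|exact: closed_eq].
have [||c Sc cmin] := @compact_EVT_min _ R (fun y => dot (y *m A) y) S _ compS.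
  by exists ((Num.sqrt (dot e e))^-1 *: e); exact: normS.
  by apply: continuous_subspaceT; exact: continuous_quadratic.
set mu := dot _ _ in cmin.
(* Both sides are homogeneous of degree two, so the minimum on the sphere bounds the form
   everywhere. *)
have mu_le y : mu * dot y y <= dot (y *m A) y.
  have [->|y0] := eqVneq y 0.
    by rewrite mul0mx /dot !big1 ?mulr0 // => i _; rewrite mxE mul0r.
  have := cmin _ (mem_set (normS y y0)).
  rewrite -scalemxAl dotZl dotZr mulrA -invfM -expr2 sqr_sqrtr ?dot_ge0 //.
  by rewrite mulrC ler_pdivlMr ?dot_gt0.
have c1 : dot c c = 1 by move: Sc; rewrite inE.
have /eqP : c *m (A - mu%:M) = 0.
  apply: psd_null_vector.
  - by rewrite linearB /= Asym tr_scalar_mx.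
  - by move=> y; rewrite dot_scalar_sub subr_ge0.
  - by rewrite dot_scalar_sub c1 mulr1 subrr.
rewrite mulmxBr mul_mx_scalar subr_eq0 => /eqP cA.
apply: le_trans (mu_le x); rewrite ler_wpM2r ?dot_ge0 //; apply: lam_le.
apply/eigenvalueP; exists c => //.
apply/eqP => c0; move: c1; rewrite c0 /dot big1 => [/eqP|i _].
  by rewrite eq_sym oner_eq0.
by rewrite mxE mul0r.
Qed.

End Rayleigh.

(** * Energy and maximum-norm estimates for the discrete Allen-Cahn operator *)

Section AllenCahnEstimates.
Context {R : realType} {N : nat}.
Implicit Types (u v w x y : 'cV[R]_N) (eps : R).

Lemma sum_eq_op u i : \sum_j (j == i)%:R * u j 0 = u i 0.
Proof.
by rewrite (bigD1 i) //= eqxx mul1r big1 ?addr0 // => j /negbTE ->; rewrite mul0r.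
Qed.

Lemma D1E u i : (D1 N *m u) i 0 = (mesh N)^-1 * (u i 0 - u (ord_pred i) 0).
Proof.
rewrite mxE (eq_bigr (fun j => (mesh N)^-1 * ((j == i)%:R * u j 0
    - (j == ord_pred i)%:R * u j 0))); last by move=> j _; rewrite mxE; ring.
by rewrite -mulr_sumr sumrB !sum_eq_op.
Qed.

Lemma D1trE u i : ((D1 N)^T *m u) i 0 = (mesh N)^-1 * (u i 0 - u (ordS i) 0).
Proof.
rewrite mxE (eq_bigr (fun j => (mesh N)^-1 * ((j == i)%:R * u j 0
    - (j == ordS i)%:R * u j 0))); last first.
  (* Transposition yields the condition [i == ord_pred j], that is, [ordS i == j]. *)
  move=> j _; rewrite !mxE (eq_sym i) -(can2_eq (@ordSK _) (@ord_predK _)).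
  by rewrite (eq_sym (ordS i)); ring.
by rewrite -mulr_sumr sumrB !sum_eq_op.
Qed.

Lemma laplacianE u i : (laplacian N *m u) i 0 =
  (mesh N ^+ 2)^-1 * (u (ordS i) 0 - 2 * u i 0 + u (ord_pred i) 0).
Proof.
rewrite mulNmx -mulmxA mxE D1trE !D1E ordSK -exprVn; ring.
Qed.

Lemma laplacian_form u w : (u^T *m (laplacian N *m w)) 0 0 =
  - \sum_i (D1 N *m u) i 0 * (D1 N *m w) i 0.
Proof.
rewrite mulNmx mulmxN -!mulmxA mulmxA -trmx_mul mxE; congr (- _).
rewrite mxE; apply: eq_bigr => i _.
by rewrite mxE.
Qed.

(** This is [- D <= 4 / h^2]: [(a - b)^2 <= 2 a^2 + 2 b^2] pointwise, and the periodic shift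
    preserves the sum of squares. *)
Lemma D1_sqnorm_le u :
  \sum_i (D1 N *m u) i 0 ^+ 2 <= 4 / mesh N ^+ 2 * \sum_i u i 0 ^+ 2.
Proof.
have shift : \sum_i u i 0 ^+ 2 = \sum_i u (ord_pred i) 0 ^+ 2.
  exact: (reindex_inj (@ord_pred_inj N)).
have -> : 4 / mesh N ^+ 2 * \sum_i u i 0 ^+ 2 =
    \sum_i (mesh N ^+ 2)^-1 * (2 * u i 0 ^+ 2 + 2 * u (ord_pred i) 0 ^+ 2).
  rewrite -mulr_sumr big_split /= -!mulr_sumr -shift; ring.
apply: ler_sum => i _; rewrite D1E exprMn exprVn ler_wpM2l ?invr_ge0 ?sqr_ge0 //.
have := sqr_ge0 (u i 0 + u (ord_pred i) 0); nra.
Qed.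

Lemma F_taylor_le (a b : R) : `|a| <= 1 -> `|b| <= 1 ->
  F b - F a <= - (b - a) * f a + (b - a) ^+ 2.
Proof.
rewrite !ler_norml => /andP[a1 a2] /andP[b1 b2]; rewrite /F /f -subr_ge0.
(* The exact Taylor remainder; its second factor is nonnegative since [a^2], [a b] and [b^2] are at
   most 1. *)
rewrite (_ : _ - _ = (b - a) ^+ 2 * ((6 - 3 * a ^+ 2 - 2 * a * b - b ^+ 2) / 4));
  last by field.
apply: mulr_ge0; first exact: sqr_ge0.
nra.
Qed.

(** The gradient of the energy is [- G]. The second-order error is at most [|w|^2 / eps] from the
    potential and exactly [eps / 2 * |D1 w|^2] from diffusion. *)
Lemma energy_sub_le eps x y : 0 < eps -> `|x| <= 1 -> `|y| <= 1 ->
  energy eps y - energy eps x <=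
    - \sum_j (y - x) j 0 * G eps x j 0
    + (1 / eps + 2 * eps / mesh N ^+ 2) * \sum_j (y - x) j 0 ^+ 2.
Proof.
move=> eps0 /(matrix_norm_le ler01) x1 /(matrix_norm_le ler01) y1.
set w := y - x; have -> : y = x + w by rewrite addrC subrK.
have pot : \sum_j F ((x + w) j 0) - \sum_j F (x j 0) <=
    - \sum_j w j 0 * f (x j 0) + \sum_j w j 0 ^+ 2.
  rewrite -sumrB -sumrN -big_split; apply: ler_sum => j _ /=.
  have := F_taylor_le _ _ (x1 j 0) (y1 j 0).
  by rewrite /w !mxE; set d := _ - _; rewrite addrC subrK mulNr.
have -> : \sum_j w j 0 * G eps x j 0 = eps * (w^T *m (laplacian N *m x)) 0 0
    + eps^-1 * \sum_j w j 0 * f (x j 0).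
  rewrite [in RHS]mxE !mulr_sumr -big_split; apply: eq_bigr => j _ /=.
  by rewrite /G !mxE; ring.
have quad : ((x + w)^T *m laplacian N *m (x + w)) 0 0 =
    (x^T *m laplacian N *m x) 0 0 + 2 * (w^T *m (laplacian N *m x)) 0 0
    - \sum_i (D1 N *m w) i 0 ^+ 2.
  rewrite -!mulmxA !laplacian_form mulrN mulr_sumr -!opprD -!big_split /=.
  by congr (- _); apply: eq_bigr => i _; rewrite mulmxDr mxE; ring.
rewrite /energy quad.
have := D1_sqnorm_le w.
move: pot; set P := \sum_j F _; set Q := \sum_j F _.
set S := \sum_j w j 0 ^+ 2; set Z := \sum_j _ * _; set T := \sum_i _ ^+ 2.
rewrite -(ler_pM2l (x := eps^-1)) ?invr_gt0 // => pot dw.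
have := ler_wpM2l (ltW eps0) dw.
clear quad dw x1 y1; set B := fun_of_matrix _ 0 0; set C := fun_of_matrix _ 0 0.
move: pot; set e := eps^-1; set h := (mesh N ^+ 2)^-1; lra.
Qed.

(** A discrete maximum principle: [tau0] makes both the diffusion number [k] and the reaction number
    [q] at most 1/4. *)
Lemma euler_step_norm_le1 eps (r : R) u : 0 < eps -> (0 < N)%N ->
  0 <= r <= tau0 N eps -> `|u| <= 1 -> `|u + r *: G eps u| <= 1.
Proof.
move=> eps0 N0 /andP[r0]; rewrite /tau0 le_min => /andP[r1 r2] u1.
have h0 : 0 < mesh N :> R by rewrite /mesh divr_gt0 ?mulr_gt0 ?pi_gt0 ?ltr0n.
apply/(matrix_norm_le ler01) => i j; rewrite ord1.
move/(matrix_norm_le ler01): u1 => u1.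
have := (u1 i 0, u1 (ordS i) 0, u1 (ord_pred i) 0).
rewrite mxE mxE mxE mxE laplacianE mxE mxE.
set a := u i 0; set b := u _ 0; set c := u _ 0.
set k := r * eps / mesh N ^+ 2; set q := r / eps.
have k0 : 0 <= k := divr_ge0 (mulr_ge0 r0 (ltW eps0)) (sqr_ge0 _).
have q0 : 0 <= q := divr_ge0 r0 (ltW eps0).
have k1 : k <= 1 / 4.
  rewrite ler_pdivrMr ?exprn_gt0 //; move: r1.
  rewrite ler_pdivlMr ?mulr_gt0 //; lra.
have q1 : q <= 1 / 4 by rewrite ler_pdivrMr //; lra.
rewrite (_ : a + r * _ = a + k * (b - 2 * a + c) + q * f a); last first.
  by rewrite /k /q; field; rewrite !gt_eqF.
rewrite !ler_norml => -[[/andP[a1 a2] /andP[b1 b2]] /andP[c1 c2]].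
(* Here [z (1 + z) <= 2], with slack [(1 - z) (2 + z)], and [1 - 2 k - 2 q >= 0]. *)
have half (z : R) : -1 <= z -> z <= 1 -> 0 <= 1 - 2 * k - q * (z * (1 + z)).
  move=> z1 z2; have : 0 <= q * ((1 - z) * (2 + z))
    by apply: mulr_ge0 q0 _; apply: mulr_ge0; lra.
  lra.
(* One minus the new value is this product plus [k (1 - b) + k (1 - c)]; the lower bound follows by
   changing signs. *)
have hi : 0 <= (1 - a) * (1 - 2 * k - q * (a * (1 + a))).
  by apply: mulr_ge0 (half a a1 a2); lra.
have lo : 0 <= (1 + a) * (1 - 2 * k - q * (- a * (1 - a))).
  by apply: mulr_ge0 (half (- a) _ _); lra.
have kb1 : 0 <= k * (1 - b) by apply: mulr_ge0 => //; lra.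
have kb2 : 0 <= k * (1 + b) by apply: mulr_ge0 => //; lra.
have kc1 : 0 <= k * (1 - c) by apply: mulr_ge0 => //; lra.
have kc2 : 0 <= k * (1 + c) by apply: mulr_ge0 => //; lra.
by apply/andP; split; rewrite /f; lra.
Qed.

End AllenCahnEstimates.

(** * Conversions between the Runge-Kutta, Shu-Osher and p-forms of the stages *)

Section RungeKuttaStages.
Context {R : realType} {N : nat}.
Context (s : nat) (a : nat -> nat -> R) (tau : R)
  (u : 'cV[R]_N) (v g : nat -> 'cV[R]_N) (v0 : v 0 = u)
  (v_stage : forall i, (1 <= i <= s)%N ->
     v i = u + tau *: \sum_(0 <= j < i) a i j *: g j).

(** Weights of sum 1 reproduce [u], and exchanging the sums collects the weight of each [g k]. Both
    the p-form and the Shu-Osher form come from this. *)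
Lemma sum_stages (c : nat -> R) i : (1 <= i <= s.+1)%N ->
  \sum_(0 <= k < i) c k = 1 ->
  \sum_(0 <= k < i) c k *: v k =
    u + tau *: \sum_(0 <= k < i) (\sum_(k.+1 <= l < i) c l * a l k) *: g k.
Proof.
move=> /andP[i1 i_s] c1.
have stage k : (0 <= k < i)%N ->
    c k *: v k = c k *: u + tau *: \sum_(0 <= j < i | (j < k)%N) (c k * a k j) *: g j.
  move=> ki; have -> : v k = u + tau *: \sum_(0 <= j < k) a k j *: g j.
    (* Stage 0 lies outside [v_stage]; its sum is empty. *)
    case: k ki => [|k] ki; first by rewrite big_geq // scaler0 addr0.
    by apply: v_stage => //=; apply: leq_trans ki i_s.
  rewrite scalerDr scalerA mulrC -scalerA scaler_sumr; congr (_ + _ *: _).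
  rewrite (big_nat_widen _ _ i); last exact: ltnW.
  by apply: eq_bigr => j _; rewrite scalerA.
rewrite (eq_big_nat _ _ stage) big_split /= -scaler_suml c1 scale1r -scaler_sumr.
congr (_ + _ *: _).
rewrite (exchange_big_dep_nat predT) //=.
by apply: eq_big_nat => k /andP[_ ki]; rewrite scaler_suml [RHS](big_nat_widenl _ 0).
Qed.

Lemma pform_stage p d i : rk_pform s a p d -> (i < s)%N ->
  (d i.+1 * tau) *: g i = v i.+1 - \sum_(0 <= k < i.+1) p i.+1 k *: v k.
Proof.
move=> [p_sum dE pa] i_s.
rewrite (sum_stages (p i.+1)) ?p_sum ?ltnS //; last exact: ltnW.
rewrite v_stage // opprD addrACA subrr add0r -scalerBr.
(* For [k = i] the inner sum is empty, so the last term of the stage survives with weight [d i.+1];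
   [pa] cancels all earlier ones. *)
rewrite [X in _ - X]big_nat_recr //= [X in _ + X *: _]big_geq // scale0r addr0.
rewrite [X in X - _]big_nat_recr //= dE //=.
rewrite [X in _ - X](eq_big_nat _ _ (F2 := fun k => a i.+1 k *: g k)).
  by rewrite addrAC subrr add0r scalerA mulrC.
move=> k /andP[_ ki]; rewrite pa //.
by congr (_ *: _); apply: eq_bigr => l _; rewrite mulrC.
Qed.

Lemma ssp_stage alpha beta i : rk_ssp s a alpha beta -> (1 <= i <= s)%N ->
  v i = \sum_(0 <= k < i) (alpha i k *: v k + (tau * beta i k) *: g k).
Proof.
move=> [betaE alpha_sum _ _ _] i_s; have /andP[i1 i2] := i_s.
rewrite big_split /= (sum_stages (alpha i)) ?alpha_sum ?i1 ?leqW //.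
rewrite v_stage // -addrA; congr (_ + _).
rewrite scaler_sumr scaler_sumr -big_split; apply: eq_big_nat => k /andP[_ ki] /=.
by rewrite !scalerA -scalerDl betaE ?ki //; congr (_ *: _); ring.
Qed.

(** As the [p j.+1 k] sum to 1, the p-form is a combination of differences [v j.+1 - v k]. Each
    telescopes into increments, and increment [m] collects the [p j.+1 k] with [k <= m], which is
    [d j.+1 * Phi s p d m j]. *)
Lemma stage_increments p d (j : 'I_s) : rk_pform s a p d -> d j.+1 != 0 ->
  tau != 0 ->
  g j = tau^-1 *: \sum_(m < s) Phi s p d m j *: (v m.+1 - v m).
Proof.
move=> pf dj tau0; apply: (scalerI (_ : d j.+1 * tau != 0)); first by rewrite mulf_neq0.
rewrite (pform_stage _ _ _ pf) // scalerA mulfK // -[v j.+1]scale1r.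
rewrite -(rk_pform_sum pf (i := j.+1)) ?ltn_ord //.
rewrite scaler_suml -sumrB scaler_sumr.
pose F m k := p j.+1 k *: (v m.+1 - v m).
transitivity (\sum_(0 <= k < j.+1) \sum_(0 <= m < j.+1 | (k <= m)%N) F m k).
  apply: eq_big_nat => k /andP[_ kj].
  by rewrite -scalerBr -(telescope_sumr v (ltnW kj)) scaler_sumr (big_nat_widenl _ 0).
(* Extending the range of [m] to [s] adds the zeros below the diagonal of [Phi]. *)
rewrite (exchange_big_dep_nat predT) //= (big_nat_widen _ _ s) // big_mkord big_mkcond.
apply: eq_bigr => m _; rewrite ltnS mxE scalerA.
case: leqP => mj; last by rewrite mulr0 scale0r.
rewrite -mulr_suml mulrCA divff // mulr1 scaler_suml.
by rewrite (big_nat_widen 0 m.+1 j.+1).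
Qed.

End RungeKuttaStages.

(** * The maximum bound on the stages and the decay of the energy *)

Lemma tau_ssp_le {R : realType} {s N : nat} {alpha beta : nat -> nat -> R}
    {eps tau : R} i k : 0 <= tau0 N eps -> (tau%:E <= tau_ssp s alpha beta N eps)%E ->
  (k < i <= s)%N -> 0 <= alpha i k -> 0 <= beta i k ->
  tau * beta i k <= alpha i k * tau0 N eps.
Proof.
move=> t0 tau_le /andP[ki i_s] al0 be0.
(* At [beta i k = 0] the ratio is [+oo], but the product form of the bound remains meaningful. *)
have [->|bN0] := eqVneq (beta i k) 0; first by rewrite mulr0 mulr_ge0.
have be_gt0 : 0 < beta i k by rewrite lt_def bN0.
suff : (tau%:E <= (alpha i k / beta i k * tau0 N eps)%:E)%E.
  by rewrite lee_fin mulrAC ler_pdivlMr.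
apply: le_trans tau_le _; rewrite /tau_ssp EFinM.
apply: lee_wpmul2r; first by rewrite lee_fin.
apply: (bigmin_inf_seq _ i) => //.
  by rewrite mem_index_iota (leq_ltn_trans _ ki).
apply: (bigmin_inf_seq _ k) => //; first by rewrite mem_index_iota.
by rewrite /ssp_ratio (negbTE bN0).
Qed.

Lemma ssp_stage_norm_le1 {R : realType} {N s : nat} {a alpha beta : nat -> nat -> R}
    {eps tau : R} {u : 'cV[R]_N} {v : nat -> 'cV[R]_N} :
  0 < eps -> (0 < N)%N -> 0 <= tau -> rk_ssp s a alpha beta ->
  (tau%:E <= tau_ssp s alpha beta N eps)%E ->
  v 0 = u ->
  (forall i, (1 <= i <= s)%N ->
    v i = u + tau *: \sum_(0 <= j < i) a i j *: G eps (v j)) ->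
  `|u| <= 1 -> forall i, (i <= s)%N -> `|v i| <= 1.
Proof.
move=> eps0 N0 tau_ge0 ssp tau_le v0 v_stage u1 i.
have [_ alpha_sum al0 be0 albe] := ssp.
elim/ltn_ind: i => -[|i] IH i_s; first by rewrite v0.
rewrite (ssp_stage _ _ _ _ _ _ v0 v_stage _ _ _ ssp) //.
rewrite -(alpha_sum i.+1) //; apply: le_trans (ler_norm_sum _ _ _) _.
rewrite !big_mkord; apply: ler_sum => k _.
have kP : (k < i.+1 <= s)%N by rewrite ltn_ord.
have := al0 _ _ kP; rewrite le_eqVlt => /predU1P[al|al].
  by rewrite (albe i.+1 k kP) -al // mulr0 !scale0r addr0 normr0.
have vk1 : `|v k| <= 1 by apply: IH; [exact: ltn_ord|exact: ltnW (leq_trans _ i_s)].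
(* Factoring out the positive [alpha] exposes an Euler step of length [tau * beta / alpha]. *)
have -> : alpha i.+1 k *: v k + (tau * beta i.+1 k) *: G eps (v k) =
  alpha i.+1 k *: (v k + (tau * beta i.+1 k / alpha i.+1 k) *: G eps (v k)).
  by move: (G eps (v k)) => y; rewrite scalerDr scalerA mulrCA divff ?mulr1 // gt_eqF.
rewrite normrZ gtr0_norm // -[leRHS]mulr1 ler_pM2l //.
apply: euler_step_norm_le1 => //; rewrite divr_ge0 ?mulr_ge0 ?be0 ?(ltW al) //=.
rewrite ler_pdivrMr // [leRHS]mulrC.
apply: (tau_ssp_le i.+1 k _ tau_le kP) => //; [|exact: ltW|exact: be0].
by rewrite /tau0 le_min !divr_ge0 ?sqr_ge0 ?mulr_ge0 ?(ltW eps0).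
Qed.

(** A quadratic form sees only the symmetric part of its matrix. *)
Lemma dot_energy_discriminant {R : realType} s p d (x : 'rV[R]_s) :
  dot (x *m energy_discriminant s p d) x = dot (x *m Phi s p d) x.
Proof.
rewrite -scalemxAr dotZl mulmxDr dotDl [X in _ + X]dot_mulmx trmxK [X in _ + X]dotC.
by field.
Qed.

Theorem theorem13 (R : realType) (eps : R) (N s : nat) (tau : R)
    (a alpha beta p : nat -> nat -> R) (d : nat -> R) (lam : R)
    (eps_gt0 : 0 < eps) (N_gt0 : (0 < N)%N) (s_gt0 : (0 < s)%N)
    (tau_gt0 : 0 < tau)
    (ssp : rk_ssp s a alpha beta)
    (pform : rk_pform s a p d)
    (d_neq0 : forall i : nat, (1 <= i <= s)%N -> d i != 0)
    (DeltaE_posdef : posdefmx (energy_discriminant s p d))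
    (lam_min : smallest_eigenvalue (energy_discriminant s p d) lam)
    (tau_le : (tau%:E <=
       Order.min (lam / (1 / eps + 2 * eps / mesh N ^+ 2))%:E
                 (tau_ssp s alpha beta N eps))%E)
    (u u' : 'cV[R]_N)
    (step : rk_step s a tau (G eps) u u')
    (u_le1 : `|u| <= 1) :
  energy eps u' <= energy eps u.
Proof.
move: tau_le; rewrite le_min lee_fin => /andP[tau_lam tau_ssp].
case: step => v [v0 v_stage ->]; rewrite -{}v0 in v_stage u_le1 *.
have v1 := ssp_stage_norm_le1 eps_gt0 N_gt0 (ltW tau_gt0) ssp tau_ssp erefl v_stage u_le1.
set K := _ + _ in tau_lam.
have K_gt0 : 0 < K.
  have diff_ge0 := divr_ge0 (mulr_ge0 (ler0n R 2) (ltW eps_gt0)) (sqr_ge0 (mesh N)).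
  exact: ltr_pwDl (divr_gt0 ltr01 eps_gt0) diff_ge0.
have [Dsym _] := DeltaE_posdef.
pose w (j : 'I_s) := v j.+1 - v j.
(* At a fixed grid point [c], the increments of all stages form one vector in stage space, where the
   energy discriminant acts. *)
pose x (c : 'I_N) : 'rV[R]_s := \row_j w j c 0.
rewrite -subr_le0 -(telescope_sumr (fun j => energy eps (v j))) // big_mkord.
apply: (@le_trans _ _ (\sum_(j < s) (- \sum_c w j c 0 * G eps (v j) c 0
    + K * \sum_c w j c 0 ^+ 2))).
  by apply: ler_sum => j _; apply: energy_sub_le => //; apply: v1 => //; exact: ltnW.
rewrite big_split /= sumrN -mulr_sumr addrC subr_le0.
rewrite exchange_big [leRHS]exchange_big /=.
have GE (j : 'I_s) c : G eps (v j) c 0 = tau^-1 * (x c *m Phi s p d) 0 j.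
  rewrite (stage_increments _ _ _ _ _ _ erefl v_stage p d j pform) ?d_neq0 ?lt0r_neq0 //=.
  rewrite mxE summxE [in RHS]mxE; congr (_ * _).
  by apply: eq_bigr => m _; rewrite mxE mulrC [x c 0 m]mxE.
have workE c : \sum_(j < s) w j c 0 * G eps (v j) c 0 =
    tau^-1 * dot (x c *m energy_discriminant s p d) (x c).
  rewrite dot_energy_discriminant /dot mulr_sumr; apply: eq_bigr => j _.
  by rewrite GE [x c 0 j]mxE mulrC mulrA.
rewrite (eq_bigr _ (fun c _ => workE c)) mulr_sumr; apply: ler_sum => c _.
have -> : \sum_(j < s) w j c 0 ^+ 2 = dot (x c) (x c).
  by apply: eq_bigr => j _; rewrite [x c 0 j]mxE expr2.
rewrite [leRHS]mulrC ler_pdivlMr //.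
(* At each grid point it remains to use [tau * K <= lam], the first time-step restriction. *)
apply: le_trans (rayleigh_le _ _ (x c) Dsym lam_min).
by rewrite mulrAC ler_wpM2r ?dot_ge0 // mulrC -ler_pdivlMr.
Qed.
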